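(* Let $(Y,\leq_{K})$ be a partially ordered vector space, where $Y$ is a Banach space and $\leq_{K}$ is the order generated by a sharp closed convex cone $K\subseteq Y$. Then $(Y,\leq_{K})$ is lower chain-complete.
   Context: Spaces are real. A cone is a nonempty set $K\subseteq Y$ with $tK\subseteq K$ for all $t>0$. The dual cone of $K$ is $K^{\circ}:=\{\varphi\in Y^{*}\mid\varphi(y)\geq 0\text{ for all }y\in K\}$, where $Y^*$ is the topological dual. $K$ is sharp if $K^{\circ}$ has nonempty interior in $Y^*$ (norm topology). The order is $x\leq_K y$ iff $y-x\in K$. A partially ordered set is lower chain-complete if every nonempty chain (totally ordered subset) that is bounded below has an infimum. *)

(* Defs.v *)
From HB Require Import structures.
From mathcomp Require Import all_boot all_order all_algebra.
From mathcomp Require Import all_classical all_reals all_analysis.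

Set Implicit Arguments.
Unset Strict Implicit.
Unset Printing Implicit Defensive.

Import Order.TTheory GRing.Theory Num.Theory.
Import numFieldNormedType.Exports.

Local Open Scope classical_set_scope.
Local Open Scope ring_scope.

Section TopologicalDual.
Context (R : realType) (Y : normedModType R).

Definition continuous_linear_form : {pred Y -> R^o} :=
  mem [set f : Y -> R^o | linear f /\ continuous f].

Record topological_dual := TopologicalDual {
  dual_fun :> Y -> R^o;
  _ : dual_fun \in continuous_linear_form
}.

HB.instance Definition _ := [isSub for dual_fun].
HB.instance Definition _ := [Choice of topological_dual by <:].

Lemma continuous_linear_form_submod_closed :
  submod_closed continuous_linear_form.
Proof.
split=> [|a f g /[!inE] -[lf cf] [lg cg]].
  by rewrite inE; split=> [b x y|]; [rewrite /= scaler0 addr0|exact: cst_continuous].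
split=> [b x y|x].
  rewrite !fctE lf lg !scalerDr !scalerA (mulrC a b) -!addrA; congr (_ + _).
  by rewrite addrCA.
by apply: cvgD; [apply: cvgZr; exact: cf|exact: cg].
Qed.

HB.instance Definition _ := GRing.isSubmodClosed.Build R (Y -> R^o)
  continuous_linear_form continuous_linear_form_submod_closed.
HB.instance Definition _ := [SubChoice_isSubLmodule of topological_dual by <:].

Implicit Types f g : topological_dual.

Definition dual_norm f : R := sup [set `|f y| | y in [set y : Y | `|y| <= 1]].

Lemma dual_linear f : linear f.
Proof. by case: f => f /=; rewrite inE => -[]. Qed.

Lemma dual_continuous f : continuous f.
Proof. by case: f => f /=; rewrite inE => -[]. Qed.

HB.instance Definition _ f := GRing.isLinear.Build R Y R^o _ f (dual_linear f).

Lemma dual_norm_has_sup f :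
  has_sup [set `|f y| | y in [set y : Y | `|y| <= 1]].
Proof.
split; first by exists `|f 0|, 0 => //=; rewrite normr0.
have [M fM] := (bounded_funP f).2
  ((linear_bounded_continuous f).2 (@dual_continuous f)) 1.
by exists M => _ [y /= y1 <-]; exact: fM.
Qed.

Lemma dual_norm_ub f y : `|y| <= 1 -> `|f y| <= dual_norm f.
Proof. by move=> y1; apply: (sup_upper_bound (dual_norm_has_sup f)); exists y. Qed.

Lemma dual_norm_le f M :
  (forall y, `|y| <= 1 -> `|f y| <= M) -> dual_norm f <= M.
Proof.
move=> fM; apply: ge_sup; first exact: (dual_norm_has_sup f).1.
by move=> _ [y /= y1 <-]; exact: fM.
Qed.

Lemma dual_norm_ge0 f : 0 <= dual_norm f.
Proof. by apply: le_trans (dual_norm_ub f (y := 0) _); rewrite ?normr0. Qed.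

Lemma dual_norm_bound f y : `|f y| <= dual_norm f * `|y|.
Proof.
have [->|y0] := eqVneq y 0; first by rewrite linear0 !normr0 mulr0.
have ny0 : 0 < `|y| by rewrite normr_gt0.
rewrite -ler_pdivrMr// mulrC -[X in X * _]ger0_norm ?invr_ge0//.
rewrite -normrZ -linearZ; apply: dual_norm_ub.
by rewrite normrZ ger0_norm ?invr_ge0// mulVf// gt_eqF.
Qed.

Lemma dual_normD f g : dual_norm (f + g) <= dual_norm f + dual_norm g.
Proof.
apply: dual_norm_le => y y1.
by rewrite (le_trans (ler_normD _ _))// lerD// dual_norm_ub.
Qed.

Let dual_normZ_le (a : R) f : dual_norm (a *: f) <= `|a| * dual_norm f.
Proof.
apply: dual_norm_le => y y1.
by rewrite [X in X <= _]normrZ ler_wpM2l// dual_norm_ub.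
Qed.

Lemma dual_normZ (a : R) f : dual_norm (a *: f) = `|a| * dual_norm f.
Proof.
apply/le_anti; rewrite dual_normZ_le /=.
have [->|a0] := eqVneq a 0; first by rewrite normr0 mul0r dual_norm_ge0.
rewrite -{1}(scalerK a0 f) (le_trans (ler_wpM2l _ (dual_normZ_le _ _)))//.
by rewrite normfV mulVKf// normr_eq0.
Qed.

Lemma dual_norm0_eq0 f : dual_norm f = 0 -> f = 0.
Proof.
move=> f0; apply/val_inj/funext => y /=; apply/eqP.
by rewrite -normr_le0 (le_trans (dual_norm_bound f y))// f0 mul0r.
Qed.

HB.instance Definition _ := Lmodule_isNormed.Build R topological_dual
  dual_normD dual_normZ dual_norm0_eq0.

End TopologicalDual.

Section Cones.
Context (R : realType) (Y : normedModType R).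
Implicit Types K : set Y.

Definition cone K := K !=set0 /\ forall t x, 0 < t -> K x -> K (t *: x).

Definition dual_cone K : set (topological_dual Y) :=
  [set f | forall y, K y -> 0 <= f y].

(* The interior is taken for the topology of the operator norm. *)
Definition sharp K := (dual_cone K)° !=set0.

Definition cone_le K (x y : Y) : Prop := K (y - x).

End Cones.

Section Orders.
Context (T : Type) (le : T -> T -> Prop).

Definition partial_order_rel :=
  [/\ forall x, le x x,
      forall x y, le x y -> le y x -> x = y
    & forall x y z, le x y -> le y z -> le x z].

Definition is_lower_bound (A : set T) (m : T) := forall x, A x -> le m x.

Definition is_infimum (A : set T) (m : T) :=
  is_lower_bound A m /\ forall b, is_lower_bound A b -> le b m.

Definition lower_chain_complete :=
  forall C : set T, C !=set0 -> total_on C le ->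
    (exists b, is_lower_bound C b) -> exists m, is_infimum C m.

End Orders.

Definition partially_ordered_vector_space (R : realType) (V : lmodType R)
    (le : V -> V -> Prop) :=
  [/\ partial_order_rel le,
      forall x y z, le x y -> le (x + z) (y + z)
    & forall t x y, 0 <= t -> le x y -> le (t *: x) (t *: y)].

(* Main.v *)
Require Import Defs.
From HB Require Import structures.
From mathcomp Require Import all_boot all_order all_algebra.
From mathcomp Require Import all_classical all_reals all_analysis.
From mathcomp Require Import lra.

(** An interior point [f] of the dual cone of [K] satisfies
    [c * `|y| <= f y] on [K] for some [c > 0]: subtract from [f] a small
    multiple of a functional norming [y].  Hence on a chain [C] bounded below
    the distance of two elements is controlled by the difference of their
    values under [f], so a sequence in [C] along which [f] tends to [inf f(C)]
    is Cauchy; as [K] is closed, its limit is the infimum of [C], unless [C]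
    has a least element.

    The norming functional comes from a sublinear functional that is minimal
    below the norm: such a functional is linear, because the directional lower
    regularization [x |-> inf_(t >= 0) (p (x + t y) - t p y)] is sublinear and
    below [p]. *)

Import Order.TTheory GRing.Theory Num.Theory.
Import numFieldNormedType.Exports.

Local Open Scope classical_set_scope.
Local Open Scope ring_scope.

Section Sublinear.
Set Implicit Arguments.
Unset Strict Implicit.
Context (R : realType) (Y : lmodType R).
Implicit Types (p q : Y -> R) (x y : Y).

Definition sublinear p :=
  (forall x y, p (x + y) <= p x + p y) /\
  (forall t x, 0 < t -> p (t *: x) <= t * p x).

Lemma sublinear0 p : sublinear p -> p 0 = 0.
Proof.
move=> [pD pZ]; have := pD 0 0; rewrite addr0.
have /(pZ _ 0) : (0 : R) < 2^-1 by lra.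
by rewrite scaler0; lra.
Qed.

Lemma sublinearZ p t x : sublinear p -> 0 <= t -> p (t *: x) = t * p x.
Proof.
move=> sp; have [_ pZ] := sp.
rewrite le_eqVlt => /predU1P[<-|t0]; first by rewrite scale0r mul0r sublinear0.
apply/le_anti; rewrite pZ//= -ler_pdivlMl//.
have := pZ t^-1 (t *: x).
by rewrite scalerA mulVf ?gt_eqF// scale1r invr_gt0; exact.
Qed.

Lemma sublinear_opp p x : sublinear p -> - p (- x) <= p x.
Proof.
by move=> sp; have := sp.1 x (- x); rewrite subrr sublinear0//; lra.
Qed.

(** The members [F i] need not be sublinear themselves; a suitable [k] may depend on the points.
    This serves both the regularization and the chains in Zorn's lemma. *)
Lemma sublinear_inf (I : Type) (D : set I) (F : I -> Y -> R) :
  D !=set0 ->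
  (forall x, has_lbound [set F i x | i in D]) ->
  (forall i j x y, D i -> D j ->
     exists2 k, D k & F k (x + y) <= F i x + F j y) ->
  (forall i t x, D i -> 0 < t -> exists2 k, D k & F k (t *: x) <= t * F i x) ->
  sublinear (fun x => inf [set F i x | i in D]).
Proof.
move=> D0 Flb FD FZ.
have D0' x : [set F i x | i in D] !=set0 by case: D0 => i Di; exists (F i x), i.
have infF i x : D i -> inf [set F i x | i in D] <= F i x.
  by move=> Di; apply: ge_inf => //; exists i.
split=> [x y|t x t0].
  rewrite -lerBlDl; apply: lb_le_inf => // _ [j Dj <-].
  rewrite lerBlDl -lerBlDr; apply: lb_le_inf => // _ [i Di <-].
  rewrite lerBlDr; have [k Dk] := FD i j x y Di Dj.
  by apply: le_trans; exact: infF.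
rewrite -ler_pdivrMl//; apply: lb_le_inf => // _ [i Di <-].
rewrite ler_pdivrMl//; have [k Dk] := FZ i t x Di t0.
by apply: le_trans; exact: infF.
Qed.

Lemma sublinear_regularization p y : sublinear p ->
  exists q, [/\ sublinear q, forall x, q x <= p x & q (- y) <= - p y].
Proof.
move=> sp; have [pD pZ] := sp.
pose F (t : R) x := p (x + t *: y) - t * p y.
pose D := [set t : R | 0 <= t].
have Flb x : has_lbound [set F t x | t in D].
  (* Subadditivity at [t *: y = (x + t *: y) + (- x)] gives this bound, uniform in [t]. *)
  exists (- p (- x)) => _ [t /= t0 <-]; rewrite /F -sublinearZ//.
  by have := pD (x + t *: y) (- x); rewrite addrAC subrr add0r; lra.
have qF t x : 0 <= t -> inf [set F t x | t in D] <= F t x.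
  by move=> t0; apply: ge_inf => //; exists t.
exists (fun x => inf [set F t x | t in D]); split.
- apply: sublinear_inf => //; first by exists 0; rewrite /D /=.
  + move=> s t u v /= s0 t0; exists (s + t); first by rewrite /D /= addr_ge0.
    have := pD (u + s *: y) (v + t *: y).
    by rewrite /F addrACA -scalerDl; lra.
  + move=> s t u /= s0 t0; exists (t * s); first by rewrite /D /= mulr_ge0// ltW.
    by rewrite /F -scalerA -scalerDr mulrBr mulrA lerD2r pZ.
- move=> x; apply: le_trans (qF 0 x _) _ => //.
  by rewrite /F scale0r mul0r addr0 subr0.
- apply: le_trans (qF 1 _ _) _ => //.
  by rewrite /F scale1r addNr mul1r sublinear0// add0r.
Qed.

(** By minimality [p] equals its regularization in each direction, so [p] is odd; an odd subadditive
    function is additive. *)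
Lemma minimal_sublinear_linear p : sublinear p ->
  (forall q, sublinear q -> (forall x, q x <= p x) -> q = p) ->
  linear (p : Y -> R^o).
Proof.
move=> sp pmin.
have pN x : p (- x) = - p x.
  have [q [sq qp qx]] := sublinear_regularization x sp.
  apply/le_anti; rewrite -{1}(pmin q sq qp) qx /=.
  by have := sublinear_opp x sp; lra.
have pD x y : p (x + y) = p x + p y.
  apply/le_anti; rewrite sp.1 /=.
  by have := sp.1 (x + y) (- y); rewrite addrK pN; lra.
move=> a x y; rewrite pD; congr (_ + _).
have [a0|a0] := leP 0 a; first exact: sublinearZ.
by rewrite -[a]opprK scaleNr pN sublinearZ ?oppr_ge0 1?ltW// -mulNr.
Qed.

(** Zorn's lemma for the reversed pointwise order: the pointwise infimum of a nonempty chain is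
    sublinear, and the empty chain is bounded by [p0]. *)
Lemma minimal_sublinear_exists p0 : sublinear p0 ->
  exists p, [/\ sublinear p, forall x, p x <= p0 x &
    forall q, sublinear q -> (forall x, q x <= p x) -> q = p].
Proof.
move=> sp0.
pose T := {p | sublinear p /\ forall x, p x <= p0 x}.
pose pt0 : T := exist _ p0 (conj sp0 (fun=> lexx _)).
pose below (p q : T) := `[< forall x, sval q x <= sval p x >].
have [||A totA|p pmin] := @ZL_preorder T pt0 below.
- by move=> p; apply/asboolP.
- move=> p q r /asboolP pq /asboolP qr; apply/asboolP => x.
  exact: le_trans (qr x) (pq x).
- have [->|/set0P A0] := eqVneq A set0.
    by exists pt0 => ? [].
  pose m x := inf [set sval p x | p in A].
  have Alb x : has_lbound [set sval p x | p in A].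
    exists (- p0 (- x)) => _ [[p [sp pp0]] _ <-] /=.
    by apply: le_trans (sublinear_opp x sp); rewrite lerN2.
  have mA (p : T) x : A p -> m x <= sval p x.
    by move=> Ap; apply: ge_inf => //; exists p.
  have sm : sublinear m.
    apply: sublinear_inf => // [p q x y Ap Aq|p t x Ap t0].
      have [/asboolP pq|/asboolP qp] := totA p q Ap Aq.
        by exists q => //; apply: le_trans ((svalP q).1.1 x y) _; rewrite lerD2r pq.
      by exists p => //; apply: le_trans ((svalP p).1.1 x y) _; rewrite lerD2l qp.
    by exists p => //; apply: (svalP p).1.2.
  have mp0 x : m x <= p0 x.
    by have [p Ap] := A0; apply: le_trans (mA p x Ap) ((svalP p).2 x).
  by exists (exist _ m (conj sm mp0)) => p Ap; apply/asboolP => x; exact: mA.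
- exists (sval p); split; [exact: (svalP p).1|exact: (svalP p).2|].
  move=> q sq qp.
  have qp0 x : q x <= p0 x by apply: le_trans (qp x) ((svalP p).2 x).
  apply/funext => x; apply/le_anti; rewrite qp /=.
  have /asboolP := pmin (exist _ q (conj sq qp0)) (asboolT qp); exact.
Qed.

End Sublinear.

Lemma norming_functional (R : realType) (Y : normedModType R) (y : Y) :
  exists f : topological_dual Y, dual_norm f <= 1 /\ f y = `|y|.
Proof.
have snorm : sublinear (fun x : Y => `|x|).
  split=> [u v|t u t0]; first exact: ler_normD.
  by rewrite normrZ gtr0_norm.
(* Regularizing the norm along [y] first forces [- p y = p (- y) <= - |y|] for every linear [p]
   below [q]. *)
have [q [sq qn qy]] := sublinear_regularization y snorm.
have [p [sp pq pmin]] := minimal_sublinear_exists sq.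
have pn x : p x <= `|x| by exact: le_trans (qn x).
have plin := minimal_sublinear_linear sp pmin.
pose pL := HB.pack (p : Y -> R^o) (GRing.isLinear.Build R Y R^o _ p plin)
  : {linear Y -> R^o}.
have pabs x : `|p x| <= `|x|.
  rewrite ler_norml pn andbT.
  by have := sublinear_opp x sp; have := pn (- x); rewrite normrN; lra.
have pcont : continuous (p : Y -> R^o).
  apply/(linear_bounded_continuous pL)/bounded_funP => r; exists r => x.
  exact: le_trans.
have pdual : (p : Y -> R^o) \in @continuous_linear_form R Y by rewrite inE.
exists (TopologicalDual pdual); split=> /=.
  by apply: dual_norm_le => x; apply: le_trans (pabs x).
apply/le_anti; rewrite pn /=.
have := pq (- y); have := (linearN pL y : p (- y) = - p y); lra.
Qed.

Lemma sharp_coercive (R : realType) (Y : normedModType R) (K : set Y) :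
  sharp K -> exists (f : topological_dual Y) (c : R), 0 < c /\
    forall y, K y -> c * `|y| <= f y.
Proof.
move=> [f /nbhs_ballP[e /= e0 fe]]; exists f, (e / 2); split; first by lra.
move=> y Ky; have [g [g1 gy]] := norming_functional y.
(* Here [g] depends on [y], but the shift has norm at most [e / 2 < e], so the constant is uniform
   in [y]. *)
have /(_ y Ky) : dual_cone K (f - (e / 2) *: g).
  apply: fe; rewrite -ball_normE /= opprB addrCA subrr addr0 normrZ.
  rewrite gtr0_norm; last by lra.
  by apply: le_lt_trans (ler_piMr _ g1) _; lra.
by rewrite /= -gy subr_ge0.
Qed.

Theorem corollary3p4 (R : realType) (Y : completeNormedModType R) (K : set Y)
  (K_cone : cone K) (K_closed : closed K) (K_convex : convex_set K)
  (K_sharp : sharp K) (Y_povs : partially_ordered_vector_space (cone_le K)) :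
  lower_chain_complete (cone_le K).
Proof.
move=> C C0 totC [b bC].
have [[le_refl _ _] _ _] := Y_povs.
have [f [c [c0 fK]]] := sharp_coercive K_sharp.
have [[y [Cy yC]]|nomin] :=
    pselect (exists y, C y /\ is_lower_bound (cone_le K) C y).
  by exists y; split=> // z; exact.
have fle x y : cone_le K x y -> c * `|y - x| <= f y - f x.
  by move=> /fK; rewrite linearB.
have fmono x y : cone_le K x y -> f x <= f y.
  move=> /fle; rewrite -[f x <= _]subr_ge0; apply: le_trans.
  by rewrite mulr_ge0// ltW.
have distC x y : C x -> C y -> c * `|x - y| <= `|f x - f y|.
  move=> Cx Cy; have [/fle h|/fle h] := totC x y Cx Cy.
    by rewrite distrC (le_trans h)// distrC ler_norm.
  by rewrite (le_trans h)// ler_norm.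
pose s := inf [set f x | x in C].
have fC_inf : has_inf [set f x | x in C].
  split; first by case: C0 => x Cx; exists (f x), x.
  by exists (f b) => _ [x Cx <-]; exact/fmono/bC.
have sC x : C x -> s <= f x.
  by move=> Cx; apply: ge_inf; [exact: fC_inf.2|exists x].
have /choice[u uP] (n : nat) : exists x, C x /\ f x < s + n.+1%:R^-1.
  have n0 : 0 < n.+1%:R^-1 :> R by rewrite invr_gt0.
  by have [_ [x Cx <-] ?] := inf_adherent n0 fC_inf; exists x.
have near_u (e : R) : 0 < e -> \forall n \near \oo, f (u n) < s + e.
  move=> e0; near=> n; apply: lt_trans (uP n).2 _; rewrite ltrD2l.
  by near: n; exact: (near_infty_natSinv_lt (PosNum e0)).
have /cauchy_cvg u_cvg : cauchy (u @ \oo).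
  apply: cauchy_exP => e e0.
  have := near_u (c * e) (mulr_gt0 c0 e0).
  case=> N _ uN; exists (u N); exists N => // n /= Nn.
  rewrite -ball_normE /= -(ltr_pM2l c0).
  apply: le_lt_trans (distC _ _ (uP N).1 (uP n).1) _.
  have := uN n Nn; have := uN N (leqnn N).
  have := sC _ (uP N).1; have := sC _ (uP n).1.
  by rewrite /= ltr_norml; lra.
exists (lim (u @ \oo)); split=> [y Cy|z zC].
(* If [f y] were least on [C], coercivity would make any [x] of [C] below [y] equal to [y], and [y]
   would be a least element. *)
- have [x [Cx xy]] : exists x, C x /\ f x < f y.
    apply: contrapT => nx; apply: nomin; exists y; split=> // x Cx.
    have [//|xy] := totC y x Cy Cx.
    have : c * `|y - x| <= 0.
      apply: le_trans (fle _ _ xy) _; rewrite subr_le0 leNgt.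
      by apply/negP => fxy; apply: nx; exists x.
    rewrite pmulr_rle0// normr_le0 subr_eq0 => /eqP <-; exact: le_refl.
  (* Eventually [f (u n) < f y], which excludes [y] below [u n]; totality then puts [y - u n] in
     [K]. *)
  apply: (closed_cvg (F := \oo) (u_ := fun n => y - u n) _ K_closed).
    have := near_u (f y - s); rewrite subr_gt0 (le_lt_trans (sC x Cx) xy).
    move=> /(_ isT); apply: filterS => n; rewrite addrC subrK => uy.
    have [yu|//] := totC y (u n) Cy (uP n).1.
    by have := fmono _ _ yu; rewrite leNgt uy.
  by apply: cvgB => //; exact: cvg_cst.
- apply: (closed_cvg (F := \oo) (u_ := fun n => u n - z) _ K_closed).
    by apply: nearW => n; exact: zC (uP n).1.
  by apply: cvgB => //; exact: cvg_cst.
Unshelve. all: by end_near.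
Qed.
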